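(* Let $P\subseteq\mathbb{R}^d$ be a lattice polytope. If $P$ is $3$-convex-normal, then $P$ is $k$-convex-normal for all $k\geq 2$.
   Context: A lattice polytope is the convex hull of finitely many points of $\mathbb{Z}^d$. For a polytope $Q\subseteq\mathbb{R}^d$ with vertex set $\mathrm{ver}(Q)$ set $G(Q):=\bigcup_{v\in\mathrm{ver}(Q)}\big((v+\mathbb{Z}^d)\cap Q\big)$. A rational polytope $P$ is called $k$-convex-normal (for a number $k$) if for all rational $c\in[2,k]$ one has $cP=G((c-1)P)+P$ (Minkowski sum). *)

(* Defs.v *)
From HB Require Import structures.
From mathcomp Require Import all_boot all_order all_algebra.
From mathcomp Require Import archimedean.
From mathcomp Require Import boolp classical_sets cardinality reals convex.

Set Implicit Arguments.
Unset Strict Implicit.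
Unset Printing Implicit Defensive.
Import Order.TTheory GRing.Theory Num.Theory.

Local Open Scope classical_set_scope.
Local Open Scope ring_scope.

Section ConvexNormality.
Context {R : realType} {d : nat}.
Implicit Types (P Q A B V : set 'rV[R]_d) (k c : R).

Definition int_points : set 'rV[R]_d := [set x | x \is a mxOver Num.int].

Definition rat_points : set 'rV[R]_d := [set x | forall i j, rational (x i j)].

Definition conv_hull V : set 'rV[R]_d :=
  smallest (@convex_set R 'rV[R]_d) V.

(* The empty set, as the hull of no points, counts as a polytope. *)
Definition lattice_polytope P : Prop :=
  exists V, [/\ finite_set V, V `<=` int_points & P = conv_hull V].

Definition rational_polytope P : Prop :=
  exists V, [/\ finite_set V, V `<=` rat_points & P = conv_hull V].

(* The face of Q on which the linear form f is maximal. *)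
Definition face (f : {linear 'rV[R]_d -> R^o}) Q : set 'rV[R]_d :=
  [set x | Q x /\ forall y, Q y -> (f y : R) <= f x].

Definition vertices Q : set 'rV[R]_d :=
  [set v | exists f : {linear 'rV[R]_d -> R^o}, face f Q = [set v]].

Definition G Q : set 'rV[R]_d :=
  \bigcup_(v in vertices Q) ([set v + z | z in int_points] `&` Q).

Definition dilate c Q : set 'rV[R]_d := [set c *: x | x in Q].

Definition minkowski_sum A B : set 'rV[R]_d :=
  [set x + y | x in A & y in B].

Definition convex_normal k P : Prop :=
  rational_polytope P /\
  forall c, rational c -> 2 <= c <= k ->
    dilate c P = minkowski_sum (G (dilate (c - 1) P)) P.

End ConvexNormality.

(* Main.v *)
(** Since [P] is a lattice polytope, its vertices are lattice points, so [G P]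
    consists of lattice points and the case [c = 2] of the hypothesis gives
    [2P = L + P] with [L] the set of lattice points of [P]. Adding [(c - 2)P]
    yields [cP = L + (c - 1)P] for every [c >= 2]. Translation by a point of [L]
    maps [G((c - 2)P)] into [G((c - 1)P)], so the decomposition
    [(c - 1)P = G((c - 2)P) + P] yields [cP = G((c - 1)P) + P], and
    convex-normality propagates from [c - 1] to [c]. *)

Require Import Defs.
From mathcomp Require Import all_boot all_order all_algebra.
From mathcomp Require Import classical_sets reals.
From mathcomp Require Import boolp interval_inference convex.
From mathcomp Require Import ring lra.

Set Implicit Arguments.
Unset Strict Implicit.
Unset Printing Implicit Defensive.
Import Order.TTheory GRing.Theory Num.Theory.

Local Open Scope classical_set_scope.
Local Open Scope ring_scope.

Section Dilation.
Context {R : realType} {d : nat}.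
Implicit Types (P Q V : set 'rV[R]_d) (c : R).

Lemma dilate1 Q : dilate 1 Q = Q.
Proof. by rewrite -[RHS]image_id; apply: eq_imagel => x _; rewrite scale1r. Qed.

Lemma dilateK c Q : c != 0 -> dilate c^-1 (dilate c Q) = Q.
Proof.
move=> c0; rewrite /dilate image_comp -[RHS]image_id.
by apply: eq_imagel => x _ /=; rewrite scalerK.
Qed.

Lemma dilate_set1 c (v : 'rV[R]_d) : dilate c [set v] = [set c *: v].
Proof. exact: image_set1. Qed.

Lemma face_dilate (f : {linear 'rV[R]_d -> R^o}) c Q :
  0 < c -> face f (dilate c Q) = dilate c (face f Q).
Proof.
move=> c0; apply/seteqP; split => [_ [[x Qx <-] mx]|_ [x [Qx mx] <-]].
  exists x => //; split => // y Qy.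
  have := mx (c *: y); rewrite !linearZ /= ler_pM2l //; apply.
  by exists y.
split; first by exists x.
by move=> _ [y Qy <-]; rewrite !linearZ /= ler_pM2l //; exact: mx.
Qed.

Lemma vertices_dilate c Q :
  0 < c -> vertices (dilate c Q) = dilate c (vertices Q).
Proof.
have sub (a : R) (A : set 'rV[R]_d) : 0 < a ->
    dilate a (vertices A) `<=` vertices (dilate a A).
  move=> a0 _ [v [f fv] <-].
  by exists f; rewrite face_dilate // fv dilate_set1.
move=> c0; apply/seteqP; split; last exact: sub.
(* The reverse inclusion is [sub] for the factor [c^-1] and the set [dilate c Q]. *)
move=> v Cv; exists (c^-1 *: v); last by rewrite scalerKV // gt_eqF.
rewrite -[Q in vertices Q](dilateK Q (lt0r_neq0 c0)).
by apply: sub; [rewrite invr_gt0 | exists v].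
Qed.

Lemma conv_hull_conv V x y (t : R) : 0 <= t <= 1 ->
  conv_hull V x -> conv_hull V y -> conv_hull V (t *: x + (1 - t) *: y).
Proof.
move=> /andP[t0 t1] Vx Vy A [cA VA].
have Ax : A x by apply: Vx.
have Ay : A y by apply: Vy.
have := cA x y (Itv01 t0 t1) (mem_set Ax) (mem_set Ay).
by move=> /set_mem.
Qed.

(** Convexity gives the inclusion from right to left: [a *: x + b *: y] is [a + b] times the convex
    combination of [x] and [y] with weight [a / (a + b)] on [x]. *)
Lemma dilate_conv_hullD V (a b : R) : 0 <= a -> 0 <= b ->
  dilate (a + b) (conv_hull V) =
  minkowski_sum (dilate a (conv_hull V)) (dilate b (conv_hull V)).
Proof.
move=> a0 b0; apply/seteqP; split.
  move=> _ [x Vx <-]; exists (a *: x); first by exists x.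
  by exists (b *: x); [exists x | rewrite scalerDl].
move=> _ [_ [x Vx <-] [_ [y Vy <-] <-]].
(* If [a + b = 0], the weight is undefined, but both factors vanish and only the origin remains. *)
have [ab0|ab0] := eqVneq (a + b) 0.
  have -> : a = 0 by lra.
  have -> : b = 0 by lra.
  by exists x => //; rewrite addr0 !scale0r addr0.
have abgt : 0 < a + b by rewrite lt_neqAle eq_sym ab0 addr_ge0.
exists ((a / (a + b)) *: x + (1 - a / (a + b)) *: y).
  apply: conv_hull_conv => //.
  by rewrite divr_ge0 ?addr_ge0 //= ler_pdivrMr // mul1r lerDl.
rewrite scalerDr !scalerA; congr (_ *: _ + _ *: _); by field.
Qed.

(* If [f] is maximal over the hull of [V] only at [v], but [v] is not in [V],
   then [V] lies in the open half-space [f < f v], hence so does its hull. *)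
Lemma vertices_conv_hull V : vertices (conv_hull V) `<=` V.
Proof.
move=> v [f fv]; apply: contrapT => nVv.
have [hv mv] : face f (conv_hull V) v by rewrite fv.
have conv_lt (s a b m : R) : 0 <= s <= 1 -> a < m -> b < m ->
    s * a + (1 - s) * b < m.
  (* One of the weights [s] and [1 - s] is at least 1/2, which keeps the inequality strict. *)
  by move=> /andP[s0 s1] am bm; have [?|?] := leP s (1 / 2); nra.
suff : [set x | (f x : R) < f v] v by rewrite /= ltxx.
apply: hv; split.
  move=> x y t /set_mem /= fx /set_mem /= fy; apply/mem_set => /=.
  by rewrite linearD !linearZ; apply: conv_lt => //; apply/andP.
move=> y Vy /=; rewrite lt_neqAle mv ?andbT; last exact: sub_gen_smallest.
apply/eqP => fyv; apply: nVv; suff <- : y = v by [].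
suff : face f (conv_hull V) y by rewrite fv.
by split; [exact: sub_gen_smallest | rewrite fyv].
Qed.

End Dilation.

Section LatticePolytopes.
Context {R : realType} {d : nat}.
Implicit Types (P Q : set 'rV[R]_d) (c : R).

Lemma int_pointsD (x y : 'rV[R]_d) :
  int_points x -> int_points y -> int_points (x + y).
Proof.
by move=> /mxOverP xZ /mxOverP yZ; apply/mxOverP => i j; rewrite mxE rpredD.
Qed.

Lemma int_pointsB (x y : 'rV[R]_d) :
  int_points x -> int_points y -> int_points (x - y).
Proof.
by move=> /mxOverP xZ /mxOverP yZ; apply/mxOverP => i j; rewrite !mxE rpredB.
Qed.

Lemma vertices_lattice_polytope P :
  lattice_polytope P -> vertices P `<=` int_points.
Proof. by move=> [V [_ VZ ->]] v /vertices_conv_hull/VZ. Qed.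

Lemma dilate_lattice_polytopeD P (a b : R) :
  lattice_polytope P -> 0 <= a -> 0 <= b ->
  dilate (a + b) P = minkowski_sum (dilate a P) (dilate b P).
Proof. by move=> [V [_ _ ->]]; exact: dilate_conv_hullD. Qed.

Lemma G_sub Q : G Q `<=` Q.
Proof. by move=> x [v _ [_ Qx]]. Qed.

Lemma G_lattice_polytope P : lattice_polytope P -> G P `<=` int_points.
Proof.
move=> lP x [v /(vertices_lattice_polytope lP) vZ [[z zZ <-] _]].
exact: int_pointsD.
Qed.

Lemma rational_sub1 c : rational c -> rational (c - 1).
Proof. by move=> [q _ <-]; exists (q - 1) => //; rewrite rmorphB rmorph1. Qed.

(** If [z = c *: v + u] with [v] a vertex of [P] and [u] integral, then
    [z + w = (c + 1) *: v + (u + (w - v))], and [w - v] is integral because [v] is a lattice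
    point. *)
Lemma G_dilate_translate P c w z : lattice_polytope P -> 0 < c ->
  P w -> int_points w -> G (dilate c P) z -> G (dilate (c + 1) P) (z + w).
Proof.
move=> lP c0 Pw wZ [v']; rewrite vertices_dilate //.
move=> -[v vP <-] [[u uZ uE] cz].
have c1 : 0 < c + 1 by rewrite addr_gt0.
exists ((c + 1) *: v); first by rewrite vertices_dilate //; exists v.
split.
  exists (u + (w - v)).
    have vZ : int_points v by exact: vertices_lattice_polytope vP.
    by apply: int_pointsD => //; apply: int_pointsB.
  rewrite -uE scalerDl scale1r -!addrA; congr (_ + _).
  by rewrite addrCA; congr (_ + _); rewrite addrCA subrr addr0.
rewrite dilate_lattice_polytopeD ?ltW // dilate1.
by exists z => //; exists w.
Qed.

(** The summand in [P] left over from splitting [2P] merges with [(c - 2)P] into [(c - 1)P]. *)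
Lemma dilate_sub_int_points_sum P c : lattice_polytope P ->
  dilate 2 P = minkowski_sum (G P) P -> 2 <= c ->
  dilate c P `<=` minkowski_sum (P `&` int_points) (dilate (c - 1) P).
Proof.
move=> lP P2 c2 x; rewrite -{1}[c](subrKC 2).
rewrite (@dilate_lattice_polytopeD P 2) ?subr_ge0 // P2.
move=> [_ [g Gg [p Pp <-]] [y Py <-]].
exists g; first by split; [exact: G_sub | exact: G_lattice_polytope Gg].
exists (p + y); last by rewrite addrA.
have -> : c - 1 = 1 + (c - 2) by ring.
rewrite dilate_lattice_polytopeD ?subr_ge0 // dilate1.
by exists p => //; exists y.
Qed.

Lemma convex_normal_step P c : lattice_polytope P ->
  dilate 2 P = minkowski_sum (G P) P -> 3 <= c ->
  dilate (c - 1) P = minkowski_sum (G (dilate (c - 1 - 1) P)) P ->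
  dilate c P = minkowski_sum (G (dilate (c - 1) P)) P.
Proof.
move=> lP P2 c3 IH; apply/seteqP; split.
  move=> x /(dilate_sub_int_points_sum lP P2); case; first by lra.
  move=> w [Pw wZ] [y]; rewrite {1}IH => -[z Gz [p Pp <-]] <-.
  exists (z + w); last by exists p => //; rewrite addrA (addrC w).
  rewrite -[c - 1](subrK 1); apply: G_dilate_translate => //; lra.
(* The reverse inclusion follows from [G Q] lying in [Q] and the additivity of dilation. *)
move=> _ [g /G_sub Gg [p Pp <-]].
rewrite -[c](subrK 1) dilate_lattice_polytopeD ?dilate1 //; last by lra.
by exists g => //; exists p.
Qed.

End LatticePolytopes.

Theorem mainTheorem1 (R : realType) (d : nat) (P : set 'rV[R]_d) :
  lattice_polytope P -> convex_normal 3 P ->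
  forall k : R, 2 <= k -> convex_normal k P.
Proof.
move=> lP [rP P3] k _; split => // c rc /andP[c2 _].
have P2 : dilate 2 P = minkowski_sum (G P) P.
  rewrite (P3 2); first by rewrite addrK dilate1.
    by exists 2 => //; rewrite rmorph_nat.
  by rewrite lexx ler_nat.
(* Since [c] is real, the induction runs on a natural number [n] with [c <= 3 + n]. The hypothesis
   settles [c <= 3]; for [c > 3], the factor [c - 1] is still at least 2 and has the bound
   [3 + (n - 1)]. *)
have [n cn] : exists n : nat, c <= 3 + n%:R.
  exists (Num.bound c); have := archi_boundP (le_trans (ler0n R 2) c2); lra.
elim: n c rc c2 cn => [|n IH] c rc c2 cn; first by apply: P3 => //; lra.
have [c3|c3] := leP c 3; first by apply: P3 => //; lra.
apply: convex_normal_step => //; first exact: ltW.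
apply: IH; [exact: rational_sub1 | lra |].
by move: cn; rewrite -natr1; lra.
Qed.
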